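(* Let $w\in S_n$ and let $\underline w$ be any reduced expression of $w$, of length $\ell$. The two weighted cones $\mathcal C_{\underline w}$ and $\mathcal S_{\underline w}$ in $\mathbb R^{\ell+n-1}$ are unimodularly equivalent, and the lattice-preserving linear map is given by the duality of faces and vertices in the pseudoline arrangement, i.e. it is the map $\Psi_{\underline w}$ (so $\mathcal S_{\underline w}\cong\mathcal C_{\underline w}$ via $\Psi_{\underline w}$). Moreover, this linear map restricts to linear bijections between the polytopes $$\pi^{-1}(\lambda)\cap\mathcal C_{\underline w}\;\cong\;\tau_{\underline w}^{-1}(\lambda)\cap\mathcal S_{\underline w}\qquad(\lambda\in\mathbb R^{n-1})$$ and between the cones $S_{\underline w}\cong C_{\underline w}$ in $\mathbb R^{\ell}$ (the latter via $\Psi_{\underline w}|_{\mathbb R^{\ell}}$).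
   Context: **Pseudoline arrangement.** Let $\underline w=s_{i_1}\cdots s_{i_\ell}$ be reduced, $s_i=(i,i+1)$. $\mathrm{pa}(\underline w)$ is the diagram with $n$ lines $l_1,\dots,l_n$ running from left to right, labelled at the left end from bottom to top; reading left to right, the $j$-th letter $s_{i_j}$ is a crossing at level $i_j$, i.e. of the two lines at heights $i_j,i_j+1$. Two lines cross at most once; the crossing of $l_k,l_m$ is the vertex $v_{(k,m)}=v_{(m,k)}$. The lines $l_k,l_m$ with $k<m$ cross exactly when $w(\alpha_k+\dots+\alpha_{m-1})<0$ (with $\alpha_i=\epsilon_i-\epsilon_{i+1}$), that is, when $w(k)>w(m)$. The right end of $l_i$ is a vertex $L_i$. A face has level $i\in\{1,\dots,n-1\}$ if it lies between heights $i$ and $i+1$. $F_i$ is the face of level $i$ unbounded to the left; $\hat F_j$ is the face of level $i_j$ bounded to the left by the $j$-th crossing. There are $\ell+n-1$ such faces. **GP-paths.** For $1\le i\le n-1$, the orientation $(l_i,l_{i+1})$ orients $l_1,\dots,l_i$ from right to left and $l_{i+1},\dots,l_n$ from left to right. An oriented path along the lines is rigorous if it never passes straight along a line $l_a$ through its crossing with a line $l_b$ when either $a<b$ and both lines are oriented to the left, or $a>b$ and both are oriented to the right. A GP-path of shape $(l_i,l_{i+1})$ is a rigorous path, for this orientation, with source $L_p$ and sink $L_q$, where $p\le i$, $q\ge i+1$, $w(i+1)\le w(p)\le w(i)$ and $w(i+1)\le w(q)\le w(i)$. $\mathcal P_{\underline w}$ is the set of all GP-paths for all orientations $(l_i,l_{i+1})$.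 **Index sets.** $J(i)=\{j: s_{i_j}=s_i\}=\{j_1<\dots<j_{n_i}\}$, $n_i=\#J(i)$, $J(0)=J(n)=\varnothing$. **GP cones.** $\mathbb R^{\ell+n-1}$ has standard basis $\hat c_1,\dots,\hat c_\ell$ (indexed by the crossings) and $c_1,\dots,c_{n-1}$; $\mathbb R^\ell$ is the span of the $\hat c_j$. Write $c_{(k,m)}=\hat c_j$ for $k<m$ if the $j$-th crossing is that of $l_k,l_m$, and $c_{(m,k)}=-c_{(k,m)}$, $c_{(k,k)}=0$. A GP-path is determined by the vertices where it changes lines, $\mathbf p=L_p\to v_{(p,a_1)}\to v_{(a_1,a_2)}\to\dots\to v_{(a_r,q)}\to L_q$; with $a_0=p$, $a_{r+1}=q$ put $c_{\mathbf p}=\sum_{s=0}^r c_{(a_s,a_{s+1})}$. Put $c_{[i:0]}=c_i$ and, for $1\le k\le n_i$, $$c_{[i:k]}=c_i-\hat c_{j_k}-2\sum_{j\in J(i),\,j>j_k}\hat c_j+\sum_{l\in J(i-1)\cup J(i+1),\,l>j_k}\hat c_l .$$ Then $C_{\underline w}=\{x\in\mathbb R^\ell: c_{\mathbf p}^t x\ge0\ \forall \mathbf p\in\mathcal P_{\underline w}\}$ and $\mathcal C_{\underline w}=\{x\in\mathbb R^{\ell+n-1}: c_{\mathbf p}^tx\ge0\ \forall\mathbf p\in\mathcal P_{\underline w},\ c_{[i:k]}^tx\ge0\ \forall\,1\le i\le n-1,\ 0\le k\le n_i\}$. $\pi:\mathbb R^{\ell+n-1}\to\mathbb R^{n-1}$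 is the projection to the last $n-1$ coordinates (those of $c_1,\dots,c_{n-1}$). **Area cones.** Here the standard basis of $\mathbb R^{\ell+n-1}$ is indexed by the faces, $\{e_F\}$; $\mathbb R^\ell$ is the span of the $e_{\hat F_j}$. For $\mathbf p\in\mathcal P_{\underline w}$ let $A_{\mathbf p}$ be the area to the left of $\mathbf p$ with respect to the orientation (the region enclosed by $\mathbf p$), a union of faces, and $e_{\mathbf p}=-\sum_{F\subset A_{\mathbf p}}e_F$. Put $e_{[i:k]}=-e_{F_i}-\sum_{r=1}^k e_{\hat F_{j_r}}$ for $0\le k\le n_i$. Then $S_{\underline w}=\{x\in\mathbb R^\ell: e_{\mathbf p}^tx\ge 0\ \forall\mathbf p\in\mathcal P_{\underline w}\}$, $\mathcal S_{\underline w}=\{x\in\mathbb R^{\ell+n-1}: e_{\mathbf p}^tx\ge0\ \forall\mathbf p\in\mathcal P_{\underline w},\ e_{[i:k]}^tx\ge0\ \forall\,1\le i\le n-1,\ 0\le k\le n_i\}$, and $\tau_{\underline w}:\mathbb R^{\ell+n-1}\to\mathbb R^{n-1}$ is $\tau_{\underline w}(x)=(e_{[i:n_i]}^t x)_{i=1,\dots,n-1}$. **The map.** $\Psi_{\underline w}:\mathbb R^{\ell+n-1}\to\mathbb R^{\ell+n-1}$ is the linear map from the space with basis $\{e_F\}$ to the space with basis $\{\hat c_j,c_i\}$ given, for each level $i$ with $J(i)=\{j_1<\dots<j_{n_i}\}$, by $$\Psi_{\underline w}(-e_{\hat F_{j_k}})=\hat c_{j_k}+\hat c_{j_{k+1}}-\sum_{j\in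 J(i-1)\cup J(i+1),\ j_k<j<j_{k+1}}\hat c_j,\qquad \Psi_{\underline w}(-e_{F_i})=c_{[i:1]},$$ where for $k=n_i$ the term $\hat c_{j_{k+1}}$ is omitted and the sum runs over all $j>j_{n_i}$ in $J(i-1)\cup J(i+1)$, and where $c_{[i:1]}$ is read as $c_i$ if $n_i=0$. **Unimodular equivalence.** Two polytopes (or polyhedral cones) $P,Q\subset\mathbb R^d$ are unimodularly equivalent, $P\cong Q$, if there are $M\in GL_d(\mathbb Z)$ and $u\in\mathbb Z^d$ with $Q=f_M(P)+u$, where $f_M(x)=xM$.
   Formalization: Ψ itself does not map S to C as points (n=2, w=s_1: Ψ(0,-1)=(-1,1) is not in C); the theorem takes f_M(x)=xM with M the matrix of Ψ, i.e. the transpose of Ψ, mapping C onto S, with its fibres; likewise the transpose of Ψ restricted to R^ℓ for the unweighted cones. *)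

(* Defs.v *)
(* The integer n >= 1 of S_n is r.+1.  Lines, heights and levels are numbered
   from 0: lines and heights are 'I_r.+1, levels are 'I_r, and the level i lies
   between the heights i and i.+1.  Crossings are 'I_l. *)
From HB Require Import structures.
From mathcomp Require Import all_boot all_order all_algebra all_fingroup.
From mathcomp Require Import classical_sets functions reals.

Set Implicit Arguments.
Unset Strict Implicit.
Unset Printing Implicit Defensive.

Import Order.TTheory GRing.Theory Num.Theory.

Local Open Scope ring_scope.
Local Open Scope classical_set_scope.

Definition lo (r : nat) (i : 'I_r) : 'I_r.+1 := widen_ord (leqnSn r) i.
Definition hi (r : nat) (i : 'I_r) : 'I_r.+1 := lift ord0 i.

Definition simple_refl (r : nat) (i : 'I_r) : 'S_r.+1 := tperm (lo i) (hi i).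

(* Products of permutations compose from left to right, (s * t) x = t (s x).
   This is the convention under which w(k) is the height of the right end of
   l_k, so that l_k and l_m with k < m cross exactly when w(k) > w(m). *)
Definition word_perm (r : nat) (u : seq 'I_r) : 'S_r.+1 :=
  (\prod_(i <- u) simple_refl i)%g.

Definition reduced_expression (r : nat) (w : 'S_r.+1) (u : seq 'I_r) : Prop :=
  word_perm u = w /\
  forall v : seq 'I_r, word_perm v = w -> (size u <= size v)%N.

Section Arrangement.

Variables (r l : nat) (wd : l.-tuple 'I_r).

(* The slot t <= l is the vertical strip to the right of the crossings 0..t.-1
   and to the left of the crossings t..l.-1; the L_a lie in the slot l. *)
Definition height (t : nat) (a : 'I_r.+1) : 'I_r.+1 := word_perm (take t wd) a.

Definition crossing (j : 'I_l) (a b : 'I_r.+1) : bool :=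
  let i := tnth wd j in
  ((height j a == lo i) && (height j b == hi i)) ||
  ((height j b == lo i) && (height j a == hi i)).

(* A segment (t, a) is the part of the line a inside the slot t. *)
Definition segment : Type := ('I_l.+1 * 'I_r.+1)%type.

(* The orientation number i, i.e. (l_{i+1}, l_{i+2}) in 1-based numbering. *)
Definition leftward (i : 'I_r) (a : 'I_r.+1) : bool := (a <= i)%N.

Definition forbidden (i : 'I_r) (a b : 'I_r.+1) : bool :=
  [&& (a < b)%N, leftward i a & leftward i b] ||
  [&& (b < a)%N, ~~ leftward i a & ~~ leftward i b].

(* One step of a rigorous path goes through the column of the crossing j,
   which separates the slots j and j.+1, and either changes lines at this
   crossing or stays on the same line. *)
Definition rigorous_step (i : 'I_r) (x y : segment) : bool :=
  [exists j : 'I_l,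
    [&& x.1 == (if leftward i x.2 then j.+1 else (j : nat)) :> nat,
        y.1 == (if leftward i y.2 then (j : nat) else j.+1) :> nat
      & crossing j x.2 y.2 ||
        ((x.2 == y.2) &&
         [forall b, crossing j x.2 b ==> ~~ forbidden i x.2 b])]].

(* Paths are listed with all their segments.  No condition forces the vertices
   to be distinct: the orientations have no oriented cycles. *)
Definition GP_path (i : 'I_r) (P : seq segment) : bool :=
  let w := word_perm wd in
  if P is x :: s then
    let y := last x s in
    [&& path (rigorous_step i) x s,
        (x.1 == ord_max) && (y.1 == ord_max),
        (x.2 <= lo i)%N && (hi i <= y.2)%N,
        (w (hi i) <= w x.2 <= w (lo i))%N
      & (w (hi i) <= w y.2 <= w (lo i))%N]
  else false.

(* The cell (t, h) is the part of the complement of the lines inside the slot t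
   that has exactly h lines below it.  The faces are the unions of cells which
   are adjacent through the columns of the crossings. *)
Definition cell : Type := ('I_l.+1 * 'I_r.+2)%type.

(* Adjacency of cells without meeting P: vertically, across a segment which is
   not in P; horizontally, unless the crossing separates the two cells. *)
Definition cell_adj (P : seq segment) (c d : cell) : bool :=
  [&& c.1 == d.1, d.2 == c.2.+1 :> nat
    & ~~ has (fun x : segment =>
                (x.1 == c.1) && (height x.1 x.2 == c.2 :> nat)) P] ||
  [exists j : 'I_l,
    [&& c.1 == j :> nat, d.1 == j.+1 :> nat, c.2 == d.2
      & c.2 != (tnth wd j).+1 :> nat]].

Definition immediately_left (i : 'I_r) (x : segment) (c : cell) : bool :=
  (c.1 == x.1) &&
  (c.2 == (if leftward i x.2 then height x.1 x.2 : nat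
           else (height x.1 x.2).+1) :> nat).

(* The area to the left of P: everything that can be joined, without crossing
   P, to a point immediately to the left of P. *)
Definition left_area (i : 'I_r) (P : seq segment) (c : cell) : bool :=
  [exists d : cell,
    has (fun x => immediately_left i x d) P &&
    connect [rel c1 c2 | cell_adj P c1 c2 || cell_adj P c2 c1] d c].

(* The leftmost cells of the faces \hat F_j and F_i. *)
Definition cell_hat (j : 'I_l) : cell := (lift ord0 j, lift ord0 (lo (tnth wd j))).
Definition cell_left (i : 'I_r) : cell := (ord0, lift ord0 (lo i)).

Definition J (i : 'I_r) : seq 'I_l := [seq j <- enum 'I_l | tnth wd j == i].

(* m belongs to J(i-1) or J(i+1). *)
Definition adjacent_level (i : 'I_r) (m : 'I_l) : bool :=
  ((tnth wd m).+1 == i :> nat) || (tnth wd m == i.+1 :> nat).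

Definition next_same_level (j : 'I_l) : option 'I_l :=
  ohead [seq m : 'I_l <- J (tnth wd j) | (j < m)%N].

Variable (R : realType).

(* R^(l+n-1), with the coordinates of the \hat c_j (resp. \hat F_j) first and
   those of the c_i (resp. F_i) last. *)
Local Notation space := 'rV[R]_(l + r).

Definition vec_hat (j : 'I_l) : space := delta_mx 0 (lshift r j).
Definition vec (i : 'I_r) : space := delta_mx 0 (rshift l i).

Definition dot (d : nat) (x y : 'rV[R]_d) : R := \sum_k x 0 k * y 0 k.

(* R^l as a subspace of R^(l+n-1). *)
Definition emb (x : 'rV[R]_l) : space := row_mx x 0.

(* In a reduced word at most one j contributes to the sum. *)
Definition c_vertex (k m : 'I_r.+1) : space :=
  if (k < m)%N then \sum_(j < l | crossing j k m) vec_hat j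
  else - \sum_(j < l | crossing j m k) vec_hat j.

(* Consecutive segments on the same line contribute c_vertex k k = 0. *)
Definition c_path (P : seq segment) : space :=
  \sum_(xy <- zip P (behead P)) c_vertex xy.1.2 xy.2.2.

Definition c_after (i : 'I_r) (j0 : 'I_l) : space :=
  vec i - vec_hat j0
  - 2 *: (\sum_(j <- J i | (j0 < j)%N) vec_hat j)
  + \sum_(m < l | adjacent_level i m && (j0 < m)%N) vec_hat m.

(* c_[i:k]; only meant for k <= size (J i). *)
Definition c_bracket (i : 'I_r) (k : nat) : space :=
  if k is k'.+1 then
    if onth (J i) k' is Some j then c_after i j else 0
  else vec i.

Definition C_cone : set 'rV[R]_l :=
  [set x | forall i P, GP_path i P -> 0 <= dot (c_path P) (emb x)].

Definition weighted_C_cone : set space :=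
  [set x | (forall i P, GP_path i P -> 0 <= dot (c_path P) x) /\
           (forall i k, (k <= size (J i))%N -> 0 <= dot (c_bracket i k) x)].

Definition pi_map (x : space) : 'rV[R]_r := rsubmx x.

Definition e_path (i : 'I_r) (P : seq segment) : space :=
  - (\sum_(j < l | left_area i P (cell_hat j)) vec_hat j
     + \sum_(m < r | left_area i P (cell_left m)) vec m).

Definition e_bracket (i : 'I_r) (k : nat) : space :=
  - vec i - \sum_(j <- take k (J i)) vec_hat j.

Definition S_cone : set 'rV[R]_l :=
  [set x | forall i P, GP_path i P -> 0 <= dot (e_path i P) (emb x)].

Definition weighted_S_cone : set space :=
  [set x | (forall i P, GP_path i P -> 0 <= dot (e_path i P) x) /\
           (forall i k, (k <= size (J i))%N -> 0 <= dot (e_bracket i k) x)].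

Definition tau_map (x : space) : 'rV[R]_r :=
  \row_i dot (e_bracket i (size (J i))) x.

(* The image of -e_{\hat F_j}. *)
Definition Psi_hat (j : 'I_l) : space :=
  let i := tnth wd j in
  if next_same_level j is Some j' then
    vec_hat j + vec_hat j'
    - \sum_(m < l | adjacent_level i m && (j < m < j')%N) vec_hat m
  else vec_hat j - \sum_(m < l | adjacent_level i m && (j < m)%N) vec_hat m.

(* The image of -e_{F_i}. *)
Definition Psi_left (i : 'I_r) : space :=
  c_bracket i (if J i is [::] then 0%N else 1%N).

Definition Psi (x : space) : space :=
  \sum_(j < l) (- x 0 (lshift r j)) *: Psi_hat j
  + \sum_(i < r) (- x 0 (rshift l i)) *: Psi_left i.

End Arrangement.

Arguments C_cone {r l} wd R _.
Arguments weighted_C_cone {r l} wd R _.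
Arguments S_cone {r l} wd R _.
Arguments weighted_S_cone {r l} wd R _.

Section Unimodular.

Variables (R : realType) (d : nat).

Definition f_map (M : 'M[int]_d) (x : 'rV[R]_d) : 'rV[R]_d :=
  x *m map_mx intr M.

Definition unimodularly_equivalent (P Q : set 'rV[R]_d) : Prop :=
  exists (M : 'M[int]_d) (u : 'rV[int]_d),
    M \in unitmx /\ Q = [set f_map M x + map_mx intr u | x in P].

(* M is the matrix of f in the usual sense: its k-th column consists of the
   coordinates of the image of the k-th basis vector.  Since f_map multiplies
   rows by M, f_map M is then the adjoint of f: the dot product of f_map M x
   and v is that of x and f v.  If f sends the vectors v defining a cone by
   inequalities v^t y >= 0 to vectors defining another one, it is f_map M that
   relates the points of the two cones. *)
Definition matrix_of (f : 'rV[R]_d -> 'rV[R]_d) (M : 'M[int]_d) : Prop :=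
  forall k, f (delta_mx 0 k) = map_mx intr (col k M)^T.

End Unimodular.

(* Main.v *)
(* f_map M is the adjoint of Psi, so it suffices that Psi maps the inequalities
   of one cone to those of the other. The bracket vectors telescope along each
   level. For a path P, let W be the winding number of P around a cell. Summing
   Psi over the faces weighted by W, the coefficient at a crossing is W(left) +
   W(right) - W(top) - W(bottom), i.e. the change of the multiplicity of P
   along one of the two lines through the crossing, and this counts the turns
   of P there: the image of the weighted sum is c_P.
   It remains to see that W is the indicator function of the left area.
   Crossing a column changes W only between the two heights of the crossing. As
   the word is reduced, the lower of the two crossing lines has the smaller
   label before the crossing, hence is leftward if the other one is. So W >= 0
   propagates from the empty leftmost slot to the right, comparing the new cell
   with the cell above or below it, and W <= 1 propagates in the same way from
   the rightmost slot to the left. A cell with W = 1 meets P on its way up,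
   from the left side of P. *)
Require Import Defs.
From HB Require Import structures.
From mathcomp Require Import all_boot all_order all_algebra all_fingroup.
From mathcomp Require Import classical_sets functions reals.
From mathcomp Require Import zify ring.

Set Implicit Arguments.
Unset Strict Implicit.
Unset Printing Implicit Defensive.

Import Order.TTheory GRing.Theory Num.Theory.

Local Open Scope ring_scope.
Local Open Scope classical_set_scope.

(** * Crossings of lines in a reduced word *)

Section Crossings.

Variable r : nat.
Implicit Types (i k : 'I_r) (u v : seq 'I_r).

Lemma word_perm_cat u v : word_perm (u ++ v) = (word_perm u * word_perm v)%g.
Proof. exact: big_cat. Qed.

Lemma word_perm_cons k u : word_perm (k :: u) = (simple_refl k * word_perm u)%g.
Proof. exact: big_cons. Qed.

Lemma hi_val i : hi i = i.+1 :> nat. Proof. by rewrite /= /bump. Qed.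

Lemma lo_neq_hi i : lo i != hi i.
Proof. by rewrite -val_eqE /= /bump /=; lia. Qed.

Lemma simple_refl_lo i : simple_refl i (lo i) = hi i. Proof. exact: tpermL. Qed.

Lemma simple_refl_hi i : simple_refl i (hi i) = lo i. Proof. exact: tpermR. Qed.

Lemma leq_simple_refl i (x : 'I_r.+1) (h : nat) :
  h != i.+1 -> (h <= simple_refl i x)%N = (h <= x)%N.
Proof.
move=> hi1; rewrite /simple_refl.
case: tpermP => [->|->|//]; rewrite /= /bump /=; lia.
Qed.

Lemma simple_refl_inversion i (x y : 'I_r.+1) :
  (x < y)%N -> (simple_refl i y < simple_refl i x)%N -> x = lo i /\ y = hi i.
Proof.
have h := hi_val i; have h' : lo i = i :> nat by [].
move=> xy; rewrite /simple_refl.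
case: tpermP => [?|?|/eqP n1 /eqP n2]; case: tpermP => [?|?|/eqP n3 /eqP n4];
  subst; move: n1 n2 n3 n4 || idtac; rewrite -?val_eqE /=; try lia.
all: by move: h' xy; rewrite -?val_eqE /= /bump /=; split=> //; lia.
Qed.

(** Conjugation by [word_perm u2] turns the reflection of [k'] into that of [k], so the two letters
    cancel. *)
Lemma word_perm_del2 u1 u2 u3 k k' :
    word_perm u2 (lo k') = lo k -> word_perm u2 (hi k') = hi k ->
  word_perm (u1 ++ k' :: u2 ++ k :: u3) = word_perm (u1 ++ u2 ++ u3).
Proof.
move=> lok hik; rewrite !(word_perm_cat, word_perm_cons); congr (_ * _)%g.
rewrite mulgA [(_ * word_perm u2)%g]conjgC /simple_refl tpermJ lok hik.
by rewrite -mulgA [X in (_ * X)%g]mulgA tperm2 mul1g.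
Qed.

Variables (l : nat) (wd : l.-tuple 'I_r).
Implicit Types (j : 'I_l) (a b : 'I_r.+1).

Lemma height0 a : height wd 0 a = a.
Proof. by rewrite /height take0 /word_perm big_nil perm1. Qed.

Lemma heightS j a :
  height wd j.+1 a = simple_refl (tnth wd j) (height wd j a).
Proof.
rewrite /height (take_nth (tnth wd j)) ?size_tuple // -tnth_nth.
by rewrite -cats1 word_perm_cat word_perm_cons /word_perm big_nil mulg1 permM.
Qed.

Lemma height_inj t : injective (height wd t).
Proof. exact: perm_inj. Qed.

Lemma height_surj t (h : 'I_r.+1) : exists a, height wd t a = h.
Proof. by exists ((word_perm (take t wd))^-1 h)%g; rewrite /height permKV. Qed.

Lemma crossing_sym j a b : crossing wd j a b = crossing wd j b a.
Proof. by rewrite /crossing orbC. Qed.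

Lemma crossingxx j a : crossing wd j a a = false.
Proof.
rewrite /crossing orbb; apply/negP => /andP[/eqP -> lohi].
by rewrite (negPf (lo_neq_hi _)) in lohi.
Qed.

(** The form in which reducedness enters the winding arguments. *)
Definition ascending_crossings :=
  forall j a b, height wd j a = lo (tnth wd j) -> height wd j b = hi (tnth wd j) ->
  (a < b)%N.

(* Two lines crossing back could be uncrossed by deleting two letters. *)
Lemma reduced_ascending w : reduced_expression w wd -> ascending_crossings.
Proof.
case=> def_w min_w j a b aj bj; rewrite ltnNge; apply/negP => ba.
have above_j : exists t, (t <= j)%N && (height wd t a < height wd t b)%N.
  by exists j; rewrite leqnn aj bj /= /bump /=.
(* In slot 0 the line [a] is not below [b], so the crossing just before the first slot in which it
   is below is an earlier crossing of the two lines. *)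
case: (ex_minnP above_j) => -[|t] /andP[tj ab] min_t.
  by rewrite !height0 ltnNge ba in ab.
have tl : (t < l)%N by exact: leq_trans tj (ltnW (ltn_ord j)).
pose k' := tnth wd (Ordinal tl).
have /(_ _)[] := @simple_refl_inversion k' (height wd t b) (height wd t a).
- rewrite ltn_neqAle leqNgt; apply/andP; split.
    apply/eqP => /val_inj /height_inj ab'.
    by rewrite ab' ltnn in ab.
  by apply/negP => abt; have := min_t t; rewrite abt (ltnW tj) ltnn => /(_ isT).
- by rewrite -!(heightS (Ordinal tl)).
move=> bt at_.
pose u1 := take t wd; pose u2 := drop t.+1 (take j wd); pose u3 := drop j.+1 wd.
have take_j : take j wd = u1 ++ k' :: u2 :> seq _.
  rewrite -(cat_take_drop t.+1 (take j wd)) take_takel //.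
  rewrite (take_nth (tnth wd j)) ?size_tuple // -cats1 -catA /=.
  by rewrite -(tnth_nth _ wd (Ordinal tl)).
have def_wd : wd = u1 ++ k' :: u2 ++ tnth wd j :: u3 :> seq _.
  rewrite -[LHS](cat_take_drop j) take_j -catA /=.
  by rewrite (drop_nth (tnth wd j)) ?size_tuple // -tnth_nth.
have u2E c : word_perm u2 (height wd t.+1 c) = height wd j c.
  rewrite (heightS (Ordinal tl)) -/k' {2}/height take_j.
  by rewrite word_perm_cat word_perm_cons !permM.
(* Without the letters [t] and [j] the word has the same product, against minimality. *)
have := min_w (u1 ++ u2 ++ u3).
rewrite -(@word_perm_del2 u1 u2 u3 (tnth wd j) k') -?def_wd.
- move/(_ def_w).
  rewrite {1}def_wd !size_cat /= !size_cat /=; lia.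
- rewrite -[lo k'](simple_refl_hi k') -at_ -(heightS (Ordinal tl)).
  by rewrite u2E.
- rewrite -[hi k'](simple_refl_lo k') -bt -(heightS (Ordinal tl)).
  by rewrite u2E.
Qed.

Hypothesis asc : ascending_crossings.

(** After a crossing the smaller label stays above: going below again would need a crossing whose
    lower line has the larger label. *)
Lemma crossing_once j j' a b :
  crossing wd j a b -> crossing wd j' a b -> j = j'.
Proof.
wlog jj' : j j' / (j < j')%N => [wlg|].
  move=> cj cj'; apply/val_inj; case: (ltngtP j j') => // jj'.
    by congr val; exact: wlg.
  by congr val; apply/esym; exact: wlg.
wlog ab : a b / (a < b)%N => [wlg|].
  case: (ltngtP a b) => [|ba|/val_inj ->]; [exact: wlg | | by rewrite crossingxx].
  by rewrite ![crossing _ _ a b]crossing_sym; exact: wlg.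
have low m : crossing wd m a b ->
    height wd m a = lo (tnth wd m) /\ height wd m b = hi (tnth wd m).
  case/orP => /andP[/eqP h1 /eqP h2] //.
  by have := asc h1 h2; rewrite ltnNge (ltnW ab).
move=> /low[aj bj] /low[aj' bj'].
suff above t : (j < t <= j')%N -> (height wd t b < height wd t a)%N.
  by have := above j'; rewrite jj' leqnn aj' bj' hi_val /= => /(_ isT); lia.
elim: t => // t IH /andP[jt tj'].
have tl : (t < l)%N by exact: leq_trans tj' (ltnW (ltn_ord j')).
have [jt'|tj] := ltnP j t; last first.
  have -> : t = j by lia.
  by rewrite !heightS aj bj simple_refl_lo simple_refl_hi hi_val /=.
have {}IH := IH (introT andP (conj jt' (ltnW tj'))).
rewrite ltn_neqAle leqNgt; apply/andP; split.
  apply/eqP => /val_inj /height_inj ba.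
  by rewrite ba ltnn in ab.
apply/negP; rewrite !(heightS (Ordinal tl)) => /(simple_refl_inversion IH).
case=> bt at_; have := @asc (Ordinal tl) b a bt at_.
by rewrite ltnNge (ltnW ab).
Qed.

End Crossings.

(** * Winding numbers of a path and its left area *)

Section Winding.

Variables (r l : nat) (wd : l.-tuple 'I_r) (i : 'I_r).
Implicit Types (j : 'I_l) (a b : 'I_r.+1) (P : seq (segment r l)).
Implicit Types (x y : segment r l) (phi : 'I_r.+1 -> int).

Definition side a : int := if leftward i a then 1 else -1.

(** With a free weight [phi], the winding numbers at all heights and the multiplicities of single
    lines are instances of one signed count. *)
Definition slot_sum P (t : nat) phi : int :=
  \sum_(x <- P | x.1 == t :> nat) side x.2 * phi x.2.

(* The number of times P winds around the cell (t, h), computed along the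
   vertical ray going up from this cell. *)
Definition winding P (t h : nat) : int :=
  slot_sum P t (fun a => (h <= height wd t a)%N%:R).

(** The column of [j] is the one that a path enters when it leaves the segment [x]. *)
Definition through j x : bool := x.1 == (if leftward i x.2 then j.+1 else j) :> nat.

Lemma sum_cons_zip1 (T : Type) (V : nmodType) (F : T -> V) (s : seq T) (x0 : T) :
  \sum_(y <- x0 :: s) F y =
  \sum_(xy <- zip (x0 :: s) s) F xy.1 + F (last x0 s).
Proof.
elim: s x0 => [|y s IH] x0 /=; first by rewrite big_seq1 big_nil add0r.
by rewrite [LHS]big_cons IH big_cons /= addrA.
Qed.

Lemma sum_cons_zip2 (T : Type) (V : nmodType) (F : T -> V) (s : seq T) (x0 : T) :
  \sum_(y <- x0 :: s) F y = F x0 + \sum_(xy <- zip (x0 :: s) s) F xy.2.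
Proof.
elim: s x0 => [|y s IH] x0 /=; first by rewrite big_seq1 big_nil addr0.
by rewrite [LHS]big_cons IH [in RHS]big_cons.
Qed.

Lemma path_zip (T : eqType) (e : rel T) (x0 : T) (s : seq T) (xy : T * T) :
  path e x0 s -> xy \in zip (x0 :: s) s -> e xy.1 xy.2.
Proof.
elim: s x0 => [|y s IH] x0 //= /andP[xy0 /IH{}IH].
by rewrite inE => /orP[/eqP -> //|]; exact: IH.
Qed.

Lemma GP_path_step P x y : GP_path wd i P -> (x, y) \in zip P (behead P) ->
  rigorous_step wd i x y.
Proof. by case: P => //= x0 s /and5P[/path_zip h _ _ _ _] /h. Qed.


Definition passing (b : bool) (t : nat) phi (x : segment r l) : int :=
  if (x.1 == t :> nat) && (leftward i x.2 == b) then side x.2 * phi x.2 else 0.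

Lemma slot_sum_passing P t phi : slot_sum P t phi =
  \sum_(x <- P) passing true t phi x + \sum_(x <- P) passing false t phi x.
Proof.
rewrite -big_split /slot_sum big_mkcond; apply: eq_bigr => x _.
by rewrite /passing; case: eqP => //=; case: leftward; rewrite ?addr0 ?add0r.
Qed.

Lemma GP_path_ends P : GP_path wd i P ->
  exists x s, let y := last x s in
  [/\ P = x :: s, x.1 = ord_max, y.1 = ord_max, leftward i x.2 & ~~ leftward i y.2].
Proof.
case: P => //= x s /and5P[_ /andP[/eqP xl /eqP yl] /andP[xi yi] _ _].
by exists x, s; split=> //; rewrite /leftward -ltnNge.
Qed.

(* A path leaves the column of a crossing on the left along leftward lines only
   and on the right along rightward lines only, so the segments in a slot are
   met as the entries or the exits of the steps through an adjacent column. *)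
Lemma slot_sum_right_of P t phi : GP_path wd i P ->
  slot_sum P t phi = \sum_(xy <- zip P (behead P))
    (passing true t phi xy.1 + passing false t phi xy.2).
Proof.
move=> /GP_path_ends[x [s [-> _ _ xi yi]]]; rewrite slot_sum_passing big_split /=.
(* Summing over entries leaves over the last segment, summing over exits the first one; each has the
   orientation not counted in its sum. *)
rewrite sum_cons_zip1 [X in _ + X]sum_cons_zip2 /passing xi (negPf yi) !andbF.
by rewrite addr0 add0r.
Qed.

(** Here the segments left over have the counted orientation; they drop out because both lie in the
    slot [l]. *)
Lemma slot_sum_left_of P t phi : GP_path wd i P -> t != l ->
  slot_sum P t phi = \sum_(xy <- zip P (behead P))
    (passing true t phi xy.2 + passing false t phi xy.1).
Proof.
move=> /GP_path_ends[x [s [-> xl yl _ _]]] tl; rewrite slot_sum_passing big_split /=.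
rewrite sum_cons_zip2 [X in _ + X]sum_cons_zip1 /passing xl yl /= eq_sym (negPf tl) /=.
by rewrite addr0 add0r.
Qed.

Lemma eq_sum_steps P (F G : segment r l * segment r l -> int) : GP_path wd i P ->
  (forall j x y, x.1 = (if leftward i x.2 then j.+1 else j) :> nat ->
     y.1 = (if leftward i y.2 then (j : nat) else j.+1) :> nat ->
     F (x, y) = G (x, y)) ->
  \sum_(xy <- zip P (behead P)) F xy = \sum_(xy <- zip P (behead P)) G xy.
Proof.
move=> gp FG; apply: eq_big_seq => -[x y] /(GP_path_step gp)/existsP[j].
by case/and3P => /eqP xj /eqP yj _; exact: FG xj yj.
Qed.

(** Slot [j.+1] is read off from the column on its left and slot [j] from the column on its right,
    so only steps through [j] count: the entry positively and the exit negatively, whatever the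
    orientations. *)
Lemma slot_sum_step P j phi : GP_path wd i P ->
  slot_sum P j.+1 phi - slot_sum P j phi =
  \sum_(xy <- zip P (behead P) | through j xy.1) (phi xy.1.2 - phi xy.2.2).
Proof.
move=> gp; rewrite slot_sum_right_of // slot_sum_left_of ?ltn_eqF // -sumrB.
rewrite [RHS]big_mkcond; apply: eq_sum_steps => // j' x y xj yj.
rewrite /passing /through xj yj /side.
case: (leftward i x.2) (leftward i y.2) => [] [] /=;
  rewrite ?andbF ?andbT /= ?eqSS; case: eqP => ? /=; lia.
Qed.

Lemma slot_sum0 P phi : GP_path wd i P -> slot_sum P 0 phi = 0.
Proof.
move=> gp; rewrite slot_sum_right_of //; apply: big1_seq => -[x y] /= /(GP_path_step gp).
case/existsP => j /and3P[/eqP xj /eqP yj _]; rewrite /passing xj yj.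
by case: (leftward i x.2) (leftward i y.2) => [] []; rewrite ?andbF.
Qed.

(** No column lies to the right of the slot [l], so only the source and the sink are counted
    there. *)
Lemma slot_sum_last P phi : GP_path wd i P ->
  exists a b, slot_sum P l phi = phi a - phi b.
Proof.
move=> gp; have [x [s [def_P xl yl xi yi]]] := GP_path_ends gp.
exists x.2, (last x s).2; rewrite slot_sum_passing def_P.
rewrite sum_cons_zip2 [X in _ + X]sum_cons_zip1 {1}/passing xl eqxx xi /=.
rewrite {3}/passing yl eqxx (negPf yi) /= /side xi (negPf yi) mul1r mulN1r.
rewrite [X in _ + X]addrC addrACA -big_split /=.
rewrite big1_seq ?addr0 // => -[u v] /=.
rewrite -[s]/(behead (x :: s)) -def_P => /(GP_path_step gp).
case/existsP => j /and3P[/eqP uj /eqP vj _]; rewrite /passing uj vj.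
have jl := ltn_eqF (ltn_ord j).
by case: (leftward i u.2) (leftward i v.2) => [] []; rewrite /= ?jl ?andbF.
Qed.


Lemma winding0 P h : GP_path wd i P -> winding P 0 h = 0.
Proof. exact: slot_sum0. Qed.

Lemma winding_top P t : winding P t r.+1 = 0.
Proof.
apply: big1 => x _; by rewrite leqNgt ltn_ord mulr0.
Qed.

Lemma slot_sumB P t phi psi :
  slot_sum P t (fun a => phi a - psi a) = slot_sum P t phi - slot_sum P t psi.
Proof. by rewrite -sumrB; apply: eq_bigr => x _; rewrite mulrBr. Qed.

Lemma winding_below P t h : winding P t h - winding P t h.+1 =
  slot_sum P t (fun a => (height wd t a == h :> nat)%:R).
Proof.
rewrite /winding -slot_sumB; apply: eq_bigr => x _; congr (_ * _).
by case: ltngtP => //=; rewrite ?subrr ?subr0.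
Qed.

Lemma slot_sum_line P t a : slot_sum P t (fun b => (b == a)%:R) =
  side a * (count (fun x => (x.1 == t :> nat) && (x.2 == a)) P)%:R.
Proof.
rewrite -sum1_count natr_sum mulr_sumr /slot_sum big_mkcondr /=.
apply: eq_bigr => x _; case: eqP => [->|_]; by rewrite ?mulr0.
Qed.

Lemma winding_line P t (h : nat) a : height wd t a = h :> nat ->
  winding P t h = winding P t h.+1 +
    side a * (count (fun x => (x.1 == t :> nat) && (x.2 == a)) P)%:R.
Proof.
move=> ah; rewrite -slot_sum_line.
apply/eqP; rewrite addrC -subr_eq; apply/eqP.
rewrite winding_below; apply: eq_bigr => x _; congr (_ * _%:R).
by rewrite -ah -(inj_eq (@height_inj _ _ wd t)).
Qed.

Hypothesis asc : ascending_crossings wd.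

(** A step through [j] moves only between the two heights of the crossing, and only the threshold
    [(tnth wd j).+1] tells these apart. *)
Lemma winding_step P j h : GP_path wd i P -> h != (tnth wd j).+1 ->
  winding P j.+1 h = winding P j h.
Proof.
move=> gp hj; apply/eqP; rewrite -subr_eq0.
rewrite {1}/winding (_ : slot_sum P j.+1 _ =
  slot_sum P j.+1 (fun a => (h <= height wd j a)%N%:R)); last first.
  by apply: eq_bigr => x _; rewrite heightS leq_simple_refl.
rewrite slot_sum_step //; apply/eqP; apply: big1_seq => -[x y] /= /andP[xj].
move=> /(GP_path_step gp)/existsP[j' /and3P[/eqP xj' _]].
have -> : j' = j.
  by apply/val_inj; move/eqP: xj; rewrite xj'; case: leftward => // -[].
have hi1 := hi_val (tnth wd j).
case/orP => [cr|/andP[/eqP-> _]]; last by rewrite subrr.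
by case/orP: cr => /andP[/eqP-> /eqP->]; rewrite hi1;
  rewrite [(h <= _.+1)%N]leq_eqVlt (negPf hj) subrr.
Qed.

Lemma winding_ge0 P t h : GP_path wd i P -> (t <= l)%N -> 0 <= winding P t h.
Proof.
move=> gp; elim: t h => [|t IH] h tl; first by rewrite winding0.
pose j := Ordinal tl; have {}IH h' := IH h' (ltnW tl).
have [->|hj] := eqVneq h (tnth wd j).+1; last by rewrite (@winding_step P j).
have [a aj] := height_surj wd j (lo (tnth wd j)).
have [b bj] := height_surj wd j (hi (tnth wd j)).
have ab := asc aj bj.
have above : 0 <= winding P t.+1 (tnth wd j).+2.
  by rewrite (@winding_step P j) //; lia.
have below : 0 <= winding P t.+1 (tnth wd j).
  by rewrite (@winding_step P j) //; lia.
have ha : height wd t.+1 a = (tnth wd j).+1 :> nat.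
  by rewrite (heightS wd j) aj simple_refl_lo hi_val.
have hb : height wd t.+1 b = tnth wd j :> nat.
  by rewrite (heightS wd j) bj simple_refl_hi.
move: above below.
(* If [a] is leftward, the cell above bounds the new winding number from below; otherwise [b] is
   rightward too, as [a < b], and the cell below does. *)
rewrite (winding_line P hb) (winding_line P ha) /side /leftward.
by case: (leqP a i); case: (leqP b i); rewrite ?mul1r ?mulN1r ?natz; lia.
Qed.

Lemma winding_le1 P t h : GP_path wd i P -> (t <= l)%N -> winding P t h <= 1.
Proof.
(* Induction on the distance to the last slot, where the winding number is a difference of two
   indicators. *)
move=> gp tl; have -> : t = (l - (l - t))%N by lia.
elim: (l - t)%N h (leq_subr t l) => {t tl} [|t IH] h tl.
  rewrite subn0 /winding.
  have [a [b ->]] := slot_sum_last (fun a => (h <= height wd l a)%N%:R) gp.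
  by case: (h <= _)%N; case: (h <= _)%N.
have jl : (l - t.+1 < l)%N by lia.
pose j := Ordinal jl; have def_j : j.+1 = (l - t)%N by rewrite /=; lia.
have {}IH h' : winding P j.+1 h' <= 1 by rewrite def_j IH //; lia.
rewrite -[(l - t.+1)%N]/(j : nat).
have [->|hj] := eqVneq h (tnth wd j).+1; last by rewrite -winding_step.
have [a aj] := height_surj wd j (lo (tnth wd j)).
have [b bj] := height_surj wd j (hi (tnth wd j)).
have ab := asc aj bj.
have above : winding P j (tnth wd j).+2 <= 1.
  by rewrite -winding_step //; lia.
have below : winding P j (tnth wd j) <= 1.
  by rewrite -winding_step //; lia.
have ha : height wd j a = tnth wd j :> nat by rewrite aj.
have hb : height wd j b = (tnth wd j).+1 :> nat by rewrite bj hi_val.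
move: above below.
(* Before the crossing [a] is the lower line: if it is leftward, the cell below gives the bound;
   otherwise [b] is rightward and the cell above does. *)
rewrite (winding_line P ha) (winding_line P hb) /side /leftward.
by case: (leqP a i); case: (leqP b i); rewrite ?mul1r ?mulN1r ?natz; lia.
Qed.

Lemma winding_adj P (c d : cell r l) : GP_path wd i P -> cell_adj wd P c d ->
  winding P c.1 c.2 = winding P d.1 d.2.
Proof.
move=> gp /orP[/and3P[/eqP cd /eqP dc /hasPn noP]|].
  apply/eqP; rewrite -subr_eq0 cd dc winding_below.
  apply/eqP; apply: big1_seq => x /andP[/eqP xd /noP].
  by rewrite cd -(val_inj xd) eqxx /= => /negPf ->; rewrite mulr0.
by case/existsP => j /and4P[/eqP-> /eqP-> /eqP-> cj]; rewrite winding_step.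
Qed.

(** Both sides of the segment have winding number 0 or 1, they differ because [P] runs along it, and
    the orientation decides which one is 1. *)
Lemma immediately_left_winding P x (c : cell r l) : GP_path wd i P -> x \in P ->
  immediately_left wd i x c -> winding P c.1 c.2 = 1.
Proof.
move=> gp xP /andP[/eqP-> /eqP->].
have xl : (x.1 <= l)%N by rewrite -ltnS.
have := winding_ge0 (height wd x.1 x.2) gp xl.
have := winding_le1 (height wd x.1 x.2) gp xl.
have := winding_ge0 (height wd x.1 x.2).+1 gp xl.
have := winding_le1 (height wd x.1 x.2).+1 gp xl.
have := winding_line P (erefl (height wd x.1 x.2 : nat)).
have : (0 < count (fun y => (y.1 == x.1 :> nat) && (y.2 == x.2)) P)%N.
  by rewrite -has_count; apply/hasP; exists x; rewrite // !eqxx.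
by rewrite /side; case: leftward; rewrite ?mul1r ?mulN1r ?natz; lia.
Qed.

Lemma left_areaE P (c : cell r l) : GP_path wd i P ->
  left_area wd i P c = (winding P c.1 c.2 == 1).
Proof.
move=> gp; apply/existsP/idP => [[d /andP[/hasP[x xP xd]]]|].
  pose inside := [pred d : cell r l | winding P d.1 d.2 == 1].
  have closed_inside :
      closed [rel c1 c2 | cell_adj wd P c1 c2 || cell_adj wd P c2 c1] inside.
    by move=> c1 c2 /orP[] /(winding_adj gp); rewrite !inE => ->.
  move/(closed_connect closed_inside); rewrite !inE => <-.
  by rewrite (immediately_left_winding gp xP xd).
(* Go up from the cell until [P] is met; this happens before the top, where the winding number is
   0. *)
have [n] := ubnP (r.+1 - c.2)%N; elim: n c => // n IH c cn /eqP Wc.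
have cr : (c.2 < r.+1)%N.
  rewrite ltnNge; apply/negP => rc; move: Wc.
  by have -> : c.2 = r.+1 :> nat; rewrite ?winding_top //; have := ltn_ord c.2; lia.
have [a ac] := height_surj wd c.1 (Ordinal cr).
have {}ac : height wd c.1 a = c.2 :> nat by rewrite ac.
have [aP|aP] := boolP ((c.1, a) \in P).
  exists c; rewrite connect0 andbT; apply/hasP; exists (c.1, a) => //.
  rewrite /immediately_left eqxx /=; case: ifP => [_|aR]; first by rewrite ac.
  (* A rightward segment would give the cell above a winding number of at least 2. *)
  have cl : (c.1 <= l)%N by have := ltn_ord c.1; lia.
  have := winding_le1 c.2.+1 gp cl.
  have := winding_line P ac; rewrite Wc /side aR.
  have : (0 < count (fun y => (y.1 == c.1 :> nat) && (y.2 == a)) P)%N.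
    by rewrite -has_count; apply/hasP; exists (c.1, a); rewrite // !eqxx.
  by rewrite mulN1r natz; lia.
pose d : cell r l := (c.1, lift ord0 (Ordinal cr)).
have cd : cell_adj wd P c d.
  rewrite /cell_adj eqxx /= /bump /= add1n eqxx /= orbC; apply/orP; right.
  apply/hasPn => -[t b] bP /=; apply/negP => /andP[/eqP tc /eqP bc].
  subst t; case/negP: aP.
  by have -> : a = b by apply: (@height_inj _ _ wd c.1); apply/val_inj; rewrite /= ac bc.
have Wd : winding P d.1 d.2 == 1 by rewrite -(winding_adj gp cd) Wc.
have [|e /andP[eP ed]] := IH d _ Wd; first by rewrite /= /bump /=; lia.
exists e; rewrite eP; apply: connect_trans ed _.
by apply: connect1; rewrite /= cd orbT.
Qed.

End Winding.

(** * [Psi] on the bracket vectors: telescoping along a level *)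

Section PsiAlgebra.

Variables (R : realType) (r l : nat) (wd : l.-tuple 'I_r).
Implicit Types (i : 'I_r) (j m n : 'I_l) (a b : 'I_r.+1).
Implicit Types (x : 'rV[R]_(l + r)) (P : seq (segment r l)).

Local Notation lev := (tnth wd).
Local Notation vec_hat := (@vec_hat r l R).
Local Notation vec := (@vec r l R).
Local Notation c_after := (c_after wd R).
Local Notation Psi_hat := (Psi_hat wd R).
Local Notation Psi_left := (Psi_left wd R).

Lemma mem_J i j : (j \in J wd i) = (lev j == i).
Proof. by rewrite mem_filter mem_enum andbT. Qed.

Lemma J_sorted i : sorted (fun m n => (m < n)%N) (J wd i).
Proof.
apply: sorted_filter => [? ? ?|]; first exact: ltn_trans.
by rewrite -(@sorted_map _ _ (val : 'I_l -> nat) ltn) val_enum_ord iota_ltn_sorted.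
Qed.

Lemma big_J (V : nmodType) i (C : pred 'I_l) (F : 'I_l -> V) :
  \sum_(j <- J wd i | C j) F j = \sum_(j | (lev j == i) && C j) F j.
Proof. by rewrite /J big_filter_cond big_enum_cond. Qed.

Lemma next_same_levelP j :
  if next_same_level wd j is Some j' then
    [/\ lev j' = lev j, (j < j')%N &
        forall m, lev m = lev j -> (j < m)%N -> (j' <= m)%N]
  else forall m, lev m = lev j -> (m <= j)%N.
Proof.
rewrite /next_same_level; set s := [seq _ <- _ | _].
have mem_s m : (m \in s) = (lev m == lev j) && (j < m)%N.
  by rewrite mem_filter mem_J andbC.
have : sorted (fun m n => (m < n)%N) s.
  by apply: sorted_filter (J_sorted _) => ? ? ?; exact: ltn_trans.
case: s mem_s => [|j' s] mem_s.
  move=> _ m mj; rewrite leqNgt; apply/negP => jm.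
  by have := mem_s m; rewrite mj eqxx jm.
rewrite /= path_sortedE => [/andP[/allP j'_min _]|? ? ?]; last exact: ltn_trans.
have := mem_s j'; rewrite mem_head => /esym/andP[/eqP j'j jj']; split=> // m mj jm.
have := mem_s m; rewrite mj eqxx jm inE => /orP[/eqP-> //|/j'_min]; exact: ltnW.
Qed.

Lemma c_afterE i j : c_after i j = vec i - vec_hat j
  - 2 *: (\sum_(m | (lev m == i) && (j < m)%N) vec_hat m)
  + \sum_(m | adjacent_level wd i m && (j < m)%N) vec_hat m.
Proof. by rewrite /Defs.c_after big_J. Qed.

Lemma adjacent_level_neq i m : adjacent_level wd i m -> lev m != i.
Proof. by rewrite /adjacent_level -val_eqE /=; lia. Qed.

(** The images are differences of consecutive brackets, the last crossing being followed by
    [c_[i:0]]; hence sums along a level telescope. *)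
Lemma Psi_hat_telescope j : Psi_hat j =
  (if next_same_level wd j is Some j' then c_after (lev j) j' else vec (lev j))
  - c_after (lev j) j.
Proof.
rewrite /Defs.Psi_hat; have := next_same_levelP j.
case: next_same_level => [j'|] nextj; rewrite !c_afterE; last first.
  rewrite [X in 2 *: X]big1 => [|m /andP[/eqP/nextj mj]]; last by rewrite ltnNge mj.
  by rewrite scaler0 subr0 !opprD !addrA subrr add0r !opprK.
case: nextj => j'j jj' j'_min.
have -> : \sum_(m | (lev m == lev j) && (j < m)%N) vec_hat m =
    vec_hat j' + \sum_(m | (lev m == lev j) && (j' < m)%N) vec_hat m.
  rewrite (bigD1 j') /= ?j'j ?eqxx //; congr (_ + _).
  apply: eq_bigl => m; case: eqP => //= mj; rewrite -val_eqE /=.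
  by have := j'_min m mj; lia.
have -> : \sum_(m | adjacent_level wd (lev j) m && (j < m)%N) vec_hat m =
    \sum_(m | adjacent_level wd (lev j) m && (j < m < j')%N) vec_hat m +
    \sum_(m | adjacent_level wd (lev j) m && (j' < m)%N) vec_hat m.
  rewrite (bigID (fun m => (m < j')%N)) /=; congr (_ + _); apply: eq_bigl => m.
    by rewrite andbA.
  have [/adjacent_level_neq|//] := boolP (adjacent_level wd (lev j) m).
  have [-> |] := eqVneq m j'; first by rewrite j'j eqxx.
  by rewrite -val_eqE /=; lia.
apply/rowP => k; rewrite !mxE; ring.
Qed.

Lemma sum_Psi_hat_from j :
  \sum_(m | (lev m == lev j) && (j <= m)%N) Psi_hat m = vec (lev j) - c_after (lev j) j.
Proof.
have [n] := ubnP (l - j)%N; elim: n j => // n IH j jn.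
rewrite (bigD1 j) /= ?eqxx //= Psi_hat_telescope.
have := next_same_levelP j; case: next_same_level => [j' [j'j jj' j'_min]|j_last].
  rewrite (eq_bigl (fun m => (lev m == lev j') && (j' <= m)%N)).
    by rewrite IH ?j'j 1?addrC ?subrKA //; have := ltn_ord j'; lia.
  move=> m; rewrite j'j; case: eqP => //= mj; rewrite -val_eqE /=.
  by have := j'_min m mj; lia.
rewrite big1 ?addr0 // => m /andP[/andP[/eqP/j_last mj jm]]; rewrite -val_eqE /=; lia.
Qed.

Definition Psi_mx : 'M[R]_(l + r) :=
  col_mx (\matrix_j - Psi_hat j) (\matrix_i - Psi_left i).

Lemma PsiE x : Psi wd x = x *m Psi_mx.
Proof.
rewrite mulmx_sum_row big_split_ord /=; congr (_ + _); apply: eq_bigr => k _.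
  by rewrite rowKu rowK scalerN scaleNr.
by rewrite rowKd rowK scalerN scaleNr.
Qed.

Lemma Psi_vec_hat j : vec_hat j *m Psi_mx = - Psi_hat j.
Proof. by rewrite -rowE rowKu rowK. Qed.

Lemma Psi_vec i : vec i *m Psi_mx = - Psi_left i.
Proof. by rewrite -rowE rowKd rowK. Qed.

Lemma Psi_left_telescope i :
  Psi_left i + \sum_(j | lev j == i) Psi_hat j = vec i.
Proof.
rewrite /Defs.Psi_left; case def_J: (J wd i) => [|j s] /=.
  by rewrite big1 ?addr0 // => j; rewrite -mem_J def_J.
have /eqP ji : lev j == i by rewrite -mem_J def_J mem_head.
rewrite def_J /= -ji (eq_bigl (fun m => (lev m == lev j) && (j <= m)%N)).
  by rewrite sum_Psi_hat_from addrC subrK.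
move=> m; case: eqP => //= mj; apply/esym.
have : m \in J wd i by rewrite mem_J mj ji.
rewrite def_J inE => /orP[/eqP->|ms]; first exact: leqnn.
have := J_sorted i; rewrite def_J /= path_sortedE => [|? ? ?]; last exact: ltn_trans.
by case/andP => /allP/(_ m ms)/ltnW.
Qed.

(** [Psi] shifts the brackets of a level cyclically, because the sum over the whole level closes up
    to [c_i]. *)
Lemma Psi_e_bracket i k : (k <= size (J wd i))%N ->
  Psi wd (e_bracket wd R i k) =
  c_bracket wd R i (if k == size (J wd i) then 0%N else k.+1).
Proof.
move=> ksz; rewrite PsiE mulmxBl mulNmx Psi_vec opprK mulmx_suml -sumrN.
under eq_bigr => j _ do rewrite Psi_vec_hat opprK.
have := Psi_left_telescope i; have := big_J i predT Psi_hat.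
under [RHS]eq_bigl => j do rewrite andbT.
move=> <-; rewrite -{1}(cat_take_drop k (J wd i)) big_cat /= addrA.
(* The partial sum is the complete one, [vec i], minus the sum over the remaining crossings. *)
move/(canRL (addrK _)) => ->; case: ltngtP ksz => // [ksz _|-> _]; last first.
  by rewrite drop_size big_nil subr0.
case def_d : (drop k (J wd i)) => [|j s].
  by move/(congr1 size): def_d; rewrite size_drop /=; lia.
have nth_j : onth (J wd i) k = Some j.
  by rewrite onthE -[k]addn0 -nth_drop -map_drop def_d.
have /eqP ji : lev j == i.
  by rewrite -mem_J -(cat_take_drop k (J wd i)) def_d mem_cat mem_head orbT.
rewrite /c_bracket /= nth_j -def_d.
have -> : \sum_(m <- drop k (J wd i)) Psi_hat m =
    \sum_(m | (lev m == lev j) && (j <= m)%N) Psi_hat m.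
  rewrite -big_J ji -{2}(cat_take_drop k (J wd i)) big_cat /=.
  have := J_sorted i; rewrite -{1}(cat_take_drop k (J wd i)) def_d.
  rewrite sorted_pairwise => [|? ? ?]; last exact: ltn_trans.
  rewrite pairwise_cat => /and3P[/allrelP tk _ /=/andP[/allP js _]].
  rewrite [X in _ = X + _]big1_seq => [|m /andP[jm mk]]; last first.
    by have := tk m j mk (mem_head _ _); lia.
  rewrite add0r !big_cons leqnn; congr (_ + _).
  rewrite [LHS]big_seq [RHS]big_seq_cond; apply: eq_bigl => m.
  by case ms: (m \in s) => //; rewrite ltnW // js.
by rewrite sum_Psi_hat_from ji opprB addrC subrK.
Qed.

End PsiAlgebra.

(** * [Psi] on the path vectors *)

Section PsiPath.

Variables (R : realType) (r l : nat) (wd : l.-tuple 'I_r) (i : 'I_r).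
Variable P : seq (segment r l).
Hypotheses (asc : ascending_crossings wd) (gp : GP_path wd i P).
Implicit Types (j m n : 'I_l) (a b : 'I_r.+1).

Local Notation lev := (tnth wd).
Local Notation vec_hat := (@vec_hat r l R).
Local Notation W := (winding wd i P).

Lemma left_area_cell_hat j :
  (left_area wd i P (cell_hat wd j))%:R = W j.+1 (lev j).+1 :> int.
Proof.
rewrite left_areaE //= /bump /= !add1n.
have := winding_ge0 asc (lev j).+1 gp (ltn_ord j).
have := winding_le1 asc (lev j).+1 gp (ltn_ord j).
by case: eqP => [->//|]; lia.
Qed.

Lemma e_pathE : e_path wd R i P = - \sum_(j < l) (W j.+1 (lev j).+1)%:~R *: vec_hat j.
Proof.
(* The faces [F_i] contain cells of slot 0, where the winding number is 0. *)
rewrite /e_path [X in _ + X]big1 => [|m]; last by rewrite left_areaE // winding0.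
rewrite addr0 big_mkcond; congr (- _); apply: eq_bigr => j _.
rewrite -left_area_cell_hat; case: left_area; first by rewrite scale1r.
by rewrite scale0r.
Qed.

Definition winding_jump j : int := W j.+1 (lev j).+1 - W j (lev j).+1.

(** Cells with [h] lines below them lie at level [h - 1], so the winding number starts from 0 and
    jumps only at crossings of that level. *)
Lemma winding_sum_jumps t h : (t <= l)%N ->
  W t h = \sum_(j : 'I_l | ((lev j).+1 == h) && (j < t)%N) winding_jump j.
Proof.
elim: t => [|t IH] tl.
  by rewrite winding0 // big1 // => j; rewrite andbF.
pose n := Ordinal tl; rewrite (bigID (pred1 n)) /= addrC.
rewrite (eq_bigl (fun j => ((lev j).+1 == h) && (j < t)%N)); last first.
  by move=> j; rewrite -val_eqE /=; lia.
rewrite -IH ?(ltnW tl) //; have [nh|nh] := eqVneq h (lev n).+1; last first.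
  rewrite big1 ?addr0 => [|j /andP[/andP[/eqP jh _] /eqP jn]].
    exact: (winding_step (j := n) gp nh).
  by rewrite jn in jh; rewrite jh eqxx in nh.
rewrite (big_pred1 n) => [|j]; first by rewrite /winding_jump -nh addrC subrK.
by rewrite andb_idl // => /eqP ->; rewrite nh eqxx /=.
Qed.

(** Summation by parts: the jump at [m] multiplies the sum of [Psi_hat] from [m] on along its level,
    which telescopes. *)
Lemma Psi_e_path_jumps : Psi wd (e_path wd R i P) =
  \sum_(m < l) (winding_jump m)%:~R *: (vec l R (lev m) - c_after wd R (lev m) m).
Proof.
rewrite e_pathE PsiE mulNmx mulmx_suml -sumrN.
transitivity (\sum_(j < l) \sum_(m | (lev m == lev j) && (m <= j)%N)
    (winding_jump m)%:~R *: Psi_hat wd R j).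
  apply: eq_bigr => j _; rewrite -scalemxAl Psi_vec_hat scalerN opprK -scaler_suml.
  by rewrite (winding_sum_jumps _ (ltn_ord j)) rmorph_sum.
rewrite (exchange_big_dep xpredT) //=; apply: eq_bigr => m _.
rewrite -sum_Psi_hat_from scaler_sumr; apply: eq_bigl => j.
by rewrite eq_sym.
Qed.

Lemma Psi_e_path_corners : Psi wd (e_path wd R i P) =
  \sum_(n < l) (W n.+1 (lev n).+1 + W n (lev n).+1 - W n (lev n).+2 - W n (lev n))%:~R
    *: vec_hat n.
Proof.
rewrite Psi_e_path_jumps.
transitivity (\sum_(m < l) (winding_jump m)%:~R *: vec_hat m
  + 2 *: (\sum_(m < l) \sum_(n | (lev n == lev m) && (m < n)%N)
      (winding_jump m)%:~R *: vec_hat n)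
  - \sum_(m < l) \sum_(n | adjacent_level wd (lev m) n && (m < n)%N)
      (winding_jump m)%:~R *: vec_hat n).
  rewrite scaler_sumr -sumrN -!big_split; apply: eq_bigr => m _ /=.
  rewrite c_afterE -!scaler_sumr; apply/rowP => k; rewrite !mxE; ring.
rewrite (exchange_big_dep xpredT) //= [X in _ - X](exchange_big_dep xpredT) //=.
rewrite scaler_sumr -sumrN -!big_split; apply: eq_bigr => n _ /=.
rewrite -!scaler_suml -!rmorph_sum /=.
(* Earlier jumps on the level of [n] add up to the winding number left of the crossing, those on the
   adjacent levels to the ones above and below it. *)
have same : \sum_(m | (lev n == lev m) && (m < n)%N) winding_jump m = W n (lev n).+1.
  by rewrite winding_sum_jumps 1?ltnW //; apply: eq_bigl => m; rewrite eqSS eq_sym.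
have adj : \sum_(m | adjacent_level wd (lev m) n && (m < n)%N) winding_jump m =
    W n (lev n).+2 + W n (lev n).
  rewrite !winding_sum_jumps 1?ltnW // (bigID (fun m => lev m == (lev n).+1 :> nat)) /=.
  by congr (_ + _); apply: eq_bigl => m; rewrite /adjacent_level; lia.
rewrite same adj scalerA -scaleNr -!scalerDl; congr (_ *: _).
rewrite /winding_jump !(rmorphD, rmorphB) /=; ring.
Qed.

(** Tracking one of the two lines through [j] suffices to count the turns there with sign. *)
Definition lower_line j : 'I_r.+1 := ((word_perm (take j wd))^-1 (lo (lev j)))%g.

Lemma height_lower_line j : height wd j (lower_line j) = lo (lev j).
Proof. by rewrite /height permKV. Qed.

(** Crossings being ascending, [lower_line j] has the smaller label, which gives the sign; as two
    lines cross once, [c_vertex] has a single summand. *)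
Lemma c_vertex_through j a b : crossing wd j a b ->
  c_vertex wd R a b =
  ((a == lower_line j)%:R - (b == lower_line j)%:R) *: vec_hat j.
Proof.
wlog ab : a b / (a < b)%N => [wlg jab|jab].
  case: (ltngtP a b) jab => [|ba|/val_inj->]; [exact: wlg | | by rewrite crossingxx].
  rewrite crossing_sym => /(wlg _ _ ba) cba.
  by rewrite -[RHS]opprK -scaleNr opprB -cba /c_vertex ba ltnNge (ltnW ba).
rewrite /c_vertex ab (big_pred1 j) => [|n]; last first.
  apply/idP/eqP => [nab|->//]; exact: crossing_once nab jab.
case/orP: jab => /andP[/eqP ja /eqP jb]; last first.
  by have := asc ja jb; rewrite ltnNge (ltnW ab).
have -> : lower_line j = a by apply/(@height_inj _ _ wd j); rewrite height_lower_line.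
by rewrite eqxx -[b == a]val_eqE gtn_eqF // subr0 scale1r.
Qed.

Lemma c_path_steps : c_path wd R P =
  \sum_(n < l) (\sum_(xy <- zip P (behead P) | through i n xy.1)
     ((xy.1.2 == lower_line n)%:R - (xy.2.2 == lower_line n)%:R))%:~R *: vec_hat n.
Proof.
under [RHS]eq_bigr => n _ do rewrite rmorph_sum scaler_suml /= big_mkcond.
rewrite exchange_big /c_path; apply: eq_big_seq => -[x y] xyP /=.
have /existsP[j /and3P[/eqP xj _ cxy]] := GP_path_step gp xyP.
rewrite -big_mkcond (big_pred1 j) => [|n]; last first.
  by rewrite /through xj; case: leftward; rewrite ?eqSS eq_sym.
(* Straight steps contribute 0 to both sides. *)
rewrite rmorphB /= !natz; case/orP: cxy => [/c_vertex_through->//|/andP[/eqP<- _]].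
by rewrite subrr scale0r /c_vertex ltnn big1 ?oppr0 // => n; rewrite crossingxx.
Qed.

Lemma Psi_e_path : Psi wd (e_path wd R i P) = c_path wd R P.
Proof.
rewrite Psi_e_path_corners c_path_steps; apply: eq_bigr => n _; congr (_%:~R *: _).
(* The coefficient in [c_path] is the change of the signed multiplicity of [lower_line n] across the
   column; on each side this is a difference of winding numbers below and above the line. *)
rewrite -(slot_sum_step n (fun a => (a == lower_line n)%:R) gp).
have lowE : slot_sum i P n (fun a => (a == lower_line n)%:R) =
    W n (lev n) - W n (lev n).+1.
  rewrite winding_below; apply: eq_bigr => x _; congr (_ * _%:R).
  rewrite -(inj_eq (@height_inj _ _ wd n)) height_lower_line.
  by rewrite -val_eqE.
have highE : slot_sum i P n.+1 (fun a => (a == lower_line n)%:R) =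
    W n.+1 (lev n).+1 - W n.+1 (lev n).+2.
  rewrite winding_below; apply: eq_bigr => x _; congr (_ * _%:R).
  rewrite -(inj_eq (@height_inj _ _ wd n.+1)) [height _ _ (lower_line _)]heightS.
  by rewrite height_lower_line simple_refl_lo -val_eqE /= /bump add1n.
rewrite lowE highE [W n.+1 (lev n).+2]winding_step ?neq_ltn ?ltnSn ?orbT //.
ring.
Qed.

End PsiPath.

(** * Integral matrices acting on cones *)

Section UnimodularMaps.

Variables (R : realType) (d : nat) (M : 'M[int]_d).
Implicit Types (x v : 'rV[R]_d) (A B : set 'rV[R]_d).

Lemma dot_f_map v x : dot v (f_map M x) = dot (v *m (map_mx intr M)^T) x.
Proof.
have dotE (y z : 'rV[R]_d) : dot y z = (y *m z^T) 0 0.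
  by rewrite mxE; apply: eq_bigr => k _; rewrite mxE.
by rewrite !dotE /f_map trmx_mul mulmxA.
Qed.

(** The square absorbs the sign produced by the diagonal entries -1 of [Psi]. *)
Lemma unitmx_det_sqr : \det (map_mx intr M : 'M[R]_d) ^+ 2 = 1 -> M \in unitmx.
Proof.
rewrite det_map_mx -rmorphXn /= => /eqP; rewrite -[1]/(1%:~R) eqr_int => /eqP detM2.
by rewrite unitmxE; apply/unitrPr; exists (\det M).
Qed.

Hypothesis M_unit : M \in unitmx.

Lemma f_map_set_bij A B : (forall x, A x <-> B (f_map M x)) ->
  set_bij A B (f_map M).
Proof.
move=> AB; have fK : cancel (f_map (invmx M)) (@f_map R d M).
  by move=> x; rewrite /f_map -mulmxA -map_mxM mulVmx // map_mx1 mulmx1.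
have Kf : cancel (@f_map R d M) (f_map (invmx M)).
  by move=> x; rewrite /f_map -mulmxA -map_mxM mulmxV // map_mx1 mulmx1.
split; first by move=> x /AB.
  by move=> x y _ _; apply: (can_inj Kf).
by move=> y By; exists (f_map (invmx M) y); [apply/AB; rewrite fK | exact: fK].
Qed.

Lemma unimodularly_equivalent_bij A B :
  set_bij A B (f_map M) -> unimodularly_equivalent A B.
Proof.
case=> AB _ BA; exists M, 0; split=> //; rewrite map_mx0.
apply/seteqP; split=> y.
  by move=> /BA[x Ax <-]; exists x; rewrite ?addr0.
by case=> x Ax <-; rewrite addr0; exact: AB.
Qed.

End UnimodularMaps.

(** * The matrix of [Psi] and the cones it relates *)

Section PsiMatrix.

Variables (R : realType) (r l : nat) (wd : l.-tuple 'I_r).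
Implicit Types (i k : 'I_r) (j m n : 'I_l).

Local Notation vec_hat := (@vec_hat r l R).
Local Notation vec := (@vec r l R).
Local Notation Psi_mx := (Psi_mx R wd).

Lemma vec_hat_lshift j n : vec_hat j 0 (lshift r n) = (n == j)%:R.
Proof. by rewrite mxE (inj_eq (@lshift_inj _ _)). Qed.

Lemma vec_hat_rshift j k : vec_hat j 0 (rshift l k) = 0.
Proof. by rewrite mxE eq_rlshift. Qed.

Lemma vec_rshift i k : vec i 0 (rshift l k) = (k == i)%:R.
Proof. by rewrite mxE (inj_eq (@rshift_inj _ _)). Qed.

Lemma sum_vec_hat_rshift (C : pred 'I_l) k :
  (\sum_(m | C m) vec_hat m) 0 (rshift l k) = 0.
Proof. by rewrite summxE big1 // => m _; rewrite vec_hat_rshift. Qed.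

Lemma sum_vec_hat_lshift (C : pred 'I_l) n :
  ~~ C n -> (\sum_(m | C m) vec_hat m) 0 (lshift r n) = 0.
Proof.
move=> Cn; rewrite summxE big1 // => m Cm; rewrite vec_hat_lshift.
by case: eqP Cn => [->|//]; rewrite Cm.
Qed.

Lemma Psi_hat_rshift j k : Psi_hat wd R j 0 (rshift l k) = 0.
Proof.
rewrite /Psi_hat; case: next_same_level => [j'|];
  rewrite mxE [X in _ + X]mxE sum_vec_hat_rshift subr0 ?vec_hat_rshift //.
by rewrite mxE !vec_hat_rshift addr0.
Qed.

(** Makes the block of [Psi] on the crossings unitriangular up to sign. *)
Lemma Psi_hat_lshift j n : (n <= j)%N -> Psi_hat wd R j 0 (lshift r n) = (n == j)%:R.
Proof.
move=> nj; rewrite /Psi_hat; have := next_same_levelP wd j.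
case: next_same_level => [j' [_ jj' _]|_]; rewrite mxE [X in _ + X]mxE sum_vec_hat_lshift;
  rewrite ?(ltnNge j) ?nj ?andbF // subr0 ?vec_hat_lshift //.
rewrite mxE !vec_hat_lshift (_ : n == j' = false) ?addr0 //.
by rewrite -val_eqE; apply: ltn_eqF (leq_ltn_trans nj jj').
Qed.

Lemma Psi_left_rshift i k : Psi_left wd R i 0 (rshift l k) = (k == i)%:R.
Proof.
rewrite /Psi_left /c_bracket; case: (J wd i) => [|j s] /=; first exact: vec_rshift.
rewrite c_afterE !mxE !sum_vec_hat_rshift.
rewrite eq_rlshift andbF (inj_eq (@rshift_inj _ _)) mulr0 !subr0 addr0 //.
Qed.

(** [Psi] maps [R^l] into itself; this gives both the restricted map and a block triangular
    determinant. *)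
Lemma Psi_mx_ur : ursubmx Psi_mx = 0.
Proof.
apply/matrixP => j k; rewrite !mxE.
by rewrite (unsplitK (inl _)) !mxE Psi_hat_rshift oppr0.
Qed.

Lemma Psi_mx_dr : drsubmx Psi_mx = - 1%:M.
Proof.
apply/matrixP => i k; rewrite !mxE.
by rewrite (unsplitK (inr _)) !mxE Psi_left_rshift eq_sym.
Qed.

Lemma Psi_emb (x : 'rV[R]_l) : Psi wd (emb r x) = emb r (x *m ulsubmx Psi_mx).
Proof.
rewrite PsiE -[in LHS](submxK Psi_mx) mul_row_block !mul0mx !addr0.
by rewrite Psi_mx_ur mulmx0.
Qed.

Lemma det_ulsubmx_Psi_mx_sqr : \det (ulsubmx Psi_mx) ^+ 2 = 1.
Proof.
rewrite -det_tr det_trig; last first.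
  apply/is_trig_mxP => n j nj; rewrite !mxE (unsplitK (inl _)) !mxE.
  rewrite Psi_hat_lshift; last exact: ltnW.
  by have -> : n == j = false; [rewrite -val_eqE; exact: ltn_eqF | rewrite oppr0].
rewrite (eq_bigr (fun=> -1)) => [|j _]; last first.
  by rewrite !mxE (unsplitK (inl _)) !mxE Psi_hat_lshift // eqxx.
by rewrite prodr_const exprAC sqrrN !expr1n.
Qed.

Lemma det_Psi_mx_sqr : \det Psi_mx ^+ 2 = 1.
Proof.
rewrite -(submxK Psi_mx) Psi_mx_ur det_lblock exprMn det_ulsubmx_Psi_mx_sqr mul1r.
by rewrite Psi_mx_dr -scaleN1r detZ det1 mulr1 exprAC sqrrN !expr1n.
Qed.

Lemma sum_vec_hat_int (C : pred 'I_l) (k : 'I_(l + r)) :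
  (\sum_(m | C m) vec_hat m) 0 k \is a Num.int.
Proof. by rewrite summxE rpred_sum // => m _; rewrite mxE natr_int. Qed.

Lemma Psi_hat_int j (k : 'I_(l + r)) : Psi_hat wd R j 0 k \is a Num.int.
Proof.
rewrite /Psi_hat; case: next_same_level => [j'|]; rewrite !mxE.
  by rewrite rpredB ?rpredD ?natr_int ?sum_vec_hat_int.
by rewrite rpredB ?natr_int ?sum_vec_hat_int.
Qed.

Lemma Psi_left_int i (k : 'I_(l + r)) : Psi_left wd R i 0 k \is a Num.int.
Proof.
rewrite /Psi_left /c_bracket; case: (J wd i) => [|j s] /=; first by rewrite mxE natr_int.
rewrite c_afterE !mxE rpredD ?sum_vec_hat_int //.
by rewrite !rpredB ?rpredM ?natr_int ?sum_vec_hat_int.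
Qed.

Lemma Psi_mx_int : exists M : 'M[int]_(l + r), map_mx intr M = Psi_mx^T.
Proof.
(* The entries are already integers, so [Num.floor] only changes their type. *)
exists (map_mx Num.floor Psi_mx^T); apply/matrixP => a b; rewrite !mxE floorK //.
by case: fintype.split => k; rewrite !mxE rpredN;
  [exact: Psi_hat_int | exact: Psi_left_int].
Qed.

Hypothesis asc : ascending_crossings wd.

Variable M : 'M[int]_(l + r).
Hypothesis M_Psi : map_mx intr M = Psi_mx^T.

Lemma unitmx_Psi : M \in unitmx.
Proof. by apply: (@unitmx_det_sqr R); rewrite M_Psi det_tr det_Psi_mx_sqr. Qed.

Lemma matrix_of_Psi : matrix_of (fun x : 'rV[R]_(l + r) => Psi wd x) M.
Proof. by move=> k; rewrite PsiE -rowE tr_col map_row -map_trmx M_Psi trmxK. Qed.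

Lemma dot_Psi (v x : 'rV[R]_(l + r)) : dot v (f_map M x) = dot (Psi wd v) x.
Proof. by rewrite dot_f_map M_Psi trmxK PsiE. Qed.

Lemma weighted_C_cone_S_cone (x : 'rV[R]_(l + r)) :
  weighted_C_cone wd R x <-> weighted_S_cone wd R (f_map M x).
Proof.
split=> -[paths brackets]; split=> [i P gp|i k ksz].
- by rewrite dot_Psi (Psi_e_path R asc gp); exact: paths gp.
- by rewrite dot_Psi Psi_e_bracket // brackets //; case: ltngtP ksz.
- by rewrite -(Psi_e_path R asc gp) -dot_Psi; exact: paths gp.
(* [c_[i:0]] is the image of [e_[i:n_i]], and [c_[i:k+1]] that of [e_[i:k]]. *)
case: k ksz => [_|k ksz].
  by have := brackets i _ (leqnn _); rewrite dot_Psi Psi_e_bracket // eqxx.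
by have := brackets i k (ltnW ksz); rewrite dot_Psi Psi_e_bracket ?(ltnW ksz) // ltn_eqF.
Qed.

Lemma tau_f_map (x : 'rV[R]_(l + r)) : tau_map wd (f_map M x) = pi_map x.
Proof.
apply/rowP => i; rewrite !mxE dot_Psi Psi_e_bracket // eqxx /c_bracket /dot.
rewrite (bigD1 (rshift l i)) //= vec_rshift eqxx mul1r big1 ?addr0 // => k ki.
by rewrite mxE (negPf ki) mul0r.
Qed.

Let N := ulsubmx M.

Lemma map_ulsubmx_Psi : map_mx intr N = (ulsubmx Psi_mx)^T.
Proof. by rewrite map_ulsubmx M_Psi trmx_ulsub. Qed.

Lemma unitmx_Psi_hat : N \in unitmx.
Proof.
by apply: (@unitmx_det_sqr R); rewrite map_ulsubmx_Psi det_tr det_ulsubmx_Psi_mx_sqr.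
Qed.

Lemma matrix_of_Psi_hat :
  matrix_of (fun x : 'rV[R]_l => lsubmx (Psi wd (emb r x))) N.
Proof.
move=> k; rewrite Psi_emb row_mxKl -rowE tr_col map_row -map_trmx map_ulsubmx_Psi.
by rewrite trmxK.
Qed.

Lemma dot_emb (x y : 'rV[R]_l) : dot (emb r x) (emb r y) = dot x y.
Proof.
rewrite /dot big_split_ord /= [X in _ + X]big1 => [|k _]; last first.
  by rewrite row_mxEr mxE mul0r.
by rewrite addr0; apply: eq_bigr => k _; rewrite !row_mxEl.
Qed.

(** Path vectors have no component along the [F_i], so the block of [Psi] on [R^l] determines their
    images. *)
Lemma e_path_emb i P : GP_path wd i P ->
  e_path wd R i P = emb r (lsubmx (e_path wd R i P)).
Proof.
move=> gp; rewrite -[LHS]hsubmxK; congr row_mx; apply/rowP => k.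
rewrite e_pathE // !mxE summxE big1 ?oppr0 // => j _.
by rewrite mxE vec_hat_rshift mulr0.
Qed.

Lemma dot_e_path i P (x : 'rV[R]_l) : GP_path wd i P ->
  dot (e_path wd R i P) (emb r (f_map N x)) = dot (c_path wd R P) (emb r x).
Proof.
move=> gp; rewrite -(Psi_e_path R asc gp) (e_path_emb gp) Psi_emb !dot_emb dot_f_map.
by rewrite map_ulsubmx_Psi trmxK.
Qed.

Lemma C_cone_S_cone (x : 'rV[R]_l) : C_cone wd R x <-> S_cone wd R (f_map N x).
Proof.
by split=> paths i P gp; have := paths i P gp; rewrite dot_e_path.
Qed.

End PsiMatrix.

Theorem theorem1 (R : realType) (r l : nat) (w : 'S_r.+1) (wd : l.-tuple 'I_r)
    (w_reduced : reduced_expression w wd) :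
  [/\ unimodularly_equivalent (weighted_C_cone wd R) (weighted_S_cone wd R),
      unimodularly_equivalent (C_cone wd R) (S_cone wd R),
      (exists M : 'M[int]_(l + r),
        [/\ M \in unitmx,
            matrix_of (fun x : 'rV[R]_(l + r) => Psi wd x) M,
            set_bij (weighted_C_cone wd R) (weighted_S_cone wd R) (f_map M)
          & forall lambda : 'rV[R]_r,
              set_bij
                ([set x | pi_map x = lambda] `&` weighted_C_cone wd R)
                ([set x | tau_map wd x = lambda] `&` weighted_S_cone wd R)
                (f_map M)])
    & (exists N : 'M[int]_l,
        [/\ N \in unitmx,
            (forall x : 'rV[R]_l, exists y : 'rV[R]_l, Psi wd (emb r x) = emb r y),
            matrix_of (fun x : 'rV[R]_l => lsubmx (Psi wd (emb r x))) N
          & set_bij (C_cone wd R) (S_cone wd R) (f_map N)])].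
Proof.
have asc := reduced_ascending w_reduced; have [M M_Psi] := Psi_mx_int R wd.
have M_unit := unitmx_Psi M_Psi; have N_unit := unitmx_Psi_hat M_Psi.
(* Being adjoint to [Psi], the maps on points run from the C-cones to the S-cones, while [Psi] takes
   the vectors defining the S-cones to those of the C-cones. *)
have M_bij := f_map_set_bij M_unit (weighted_C_cone_S_cone asc M_Psi).
have N_bij := f_map_set_bij N_unit (C_cone_S_cone asc M_Psi).
split; [exact: unimodularly_equivalent_bij M_bij
  | exact: unimodularly_equivalent_bij N_bij | exists M | exists (ulsubmx M)].
- split=> //; first exact: matrix_of_Psi.
  move=> lambda; apply: f_map_set_bij => // x.
  by rewrite /setI /= tau_f_map // -weighted_C_cone_S_cone.
- split=> //; last exact: matrix_of_Psi_hat.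
  by move=> x; rewrite Psi_emb; eexists.
Qed.
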